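(* Let $\ell\geq 2$ be an integer. (1) Let $k\geq 2$ and let $j$ be an integer. If $\ell^{k-1}\leq j\leq \ell^k$, then there exist subgraphs $G_1,\ldots,G_{k}$ of $K_{j}$ such that $K_{j}=G_1\cup\cdots\cup G_{k}$ and each $G_i$ is $\ell$-partite (i.e., there exists a vertex-surjective homomorphism $f_i:G_i\to K_\ell$). Hence, for $\ell^{k-1}< j\leq \ell^k$, there exists an optimal quasi-homomorphism $\{f_i:G_i\to K_\ell\}_{i=1}^{k}$ from $K_{j}$ to $K_\ell$ where each $f_i:G_i\to K_\ell$ is a vertex-surjective homomorphism. (2) Let $G$ be a simple graph and $k\geq 2$. If $\ell^{k-1}<\chi(G)\leq \ell^k$, then there exists an optimal quasi-homomorphism $\{\hat{f}_i:\hat{G}_i\to K_\ell\}_{i=1}^{k}$ from $G$ to $K_\ell$ where each $\hat{f}_i:\hat{G}_i\to K_\ell$ is a vertex-surjective homomorphism (i.e., each $\hat{G}_i$ is an $\ell$-partite subgraph of $G$).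
   Context: A simple graph is an undirected graph without loops and without multiple edges. $K_n$ is the complete graph on $n$ vertices (no loops). A homomorphism $f:G\to H$ is a map $f:V(G)\to V(H)$ with $f(u)f(v)\in E(H)$ whenever $uv\in E(G)$; it is vertex-surjective if $f:V(G)\to V(H)$ is surjective. A subgraph of $G$ is a graph whose vertex and edge sets are subsets of $V(G)$, $E(G)$. The union $G_1\cup\cdots\cup G_k$ has vertex set $\bigcup_i V(G_i)$ and edge set $\bigcup_i E(G_i)$. $\chi(G)$ is the chromatic number. A simple graph is $\ell$-partite if its vertex set can be partitioned into $\ell$ disjoint nonempty subsets $V_1,\dots,V_\ell$ such that each edge connects a vertex of some $V_a$ with a vertex of some $V_b$, $a\ne b$; equivalently, if it has a vertex-surjective homomorphism to $K_\ell$. The hom-complexity $\mathrm{C}(G;H)$ is the least positive integer $k$ such that there are subgraphs $G_1,\dots,G_k$ of $G$ with $G=G_1\cup\cdots\cup G_k$ and, for each $i$, a homomorphism $G_i\to H$ ($\infty$ if no such $k$ exists). A quasi-homomorphism from $G$ to $H$ is a collection $\{f_i:G_i\to H\}_{i=1}^{k}$ where $G_1,\dots,G_k$ are subgraphs of $G$ with $G=G_1\cup\cdots\cup G_k$ and each $f_i:G_i\to H$ is a homomorphism; it is optimal if $k=\mathrm{C}(G;H)$. *)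

(* Defs.v *)
From HB Require Import structures.
From mathcomp Require Import all_boot.
From mathcomp Require Import boolp classical_sets.

Set Implicit Arguments.
Unset Strict Implicit.
Unset Printing Implicit Defensive.

Local Open Scope classical_set_scope.

(* Graphs may be infinite; an undirected edge uv is recorded as both
   [adj u v] and [adj v u]. *)
Record sgraph := SGraph {
  vertex :> Type;
  adj : vertex -> vertex -> Prop;
  adj_sym : forall u v, adj u v -> adj v u;
  adj_irr : forall u, ~ adj u u }.

Definition complete_adj n (u v : 'I_n) : Prop := u <> v.

Lemma complete_adj_sym n (u v : 'I_n) : complete_adj u v -> complete_adj v u.
Proof. by move=> uv vu; apply: uv. Qed.

Lemma complete_adj_irr n (u : 'I_n) : ~ complete_adj u u.
Proof. by apply. Qed.

Definition complete_graph (n : nat) : sgraph :=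
  SGraph (@complete_adj_sym n) (@complete_adj_irr n).

Record hom (G H : sgraph) := Hom {
  hom_fun :> G -> H;
  hom_adj : forall u v : G, adj u v -> adj (hom_fun u) (hom_fun v) }.

Definition vertex_surjective (G H : sgraph) (f : hom G H) : Prop :=
  forall y : H, exists x : G, f x = y.

(* Not necessarily induced, not necessarily spanning. *)
Record subgraph (G : sgraph) := Subgraph {
  svert : set G;
  sedge : G -> G -> Prop;
  sedge_sym : forall u v, sedge u v -> sedge v u;
  sedge_vert : forall u v, sedge u v -> svert u;
  sedge_adj : forall u v, sedge u v -> adj u v }.

Section SubgraphAsGraph.
Variables (G : sgraph) (S : subgraph G).

Definition sub_adj (u v : set_type (svert S)) : Prop :=
  sedge S (val u) (val v).

Lemma sub_adj_sym u v : sub_adj u v -> sub_adj v u.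
Proof. exact: sedge_sym. Qed.

Lemma sub_adj_irr u : ~ sub_adj u u.
Proof. by move/sedge_adj; exact: adj_irr. Qed.

Definition sub_graph : sgraph := SGraph sub_adj_sym sub_adj_irr.
End SubgraphAsGraph.

Coercion sub_graph : subgraph >-> sgraph.

Definition is_union (G : sgraph) k (S : 'I_k -> subgraph G) : Prop :=
  [set: G] = \bigcup_i svert (S i) /\
  forall u v : G, adj u v <-> exists i, sedge (S i) u v.

Definition partite (l : nat) (G : sgraph) : Prop :=
  exists P : 'I_l -> set G,
    [/\ forall a, P a !=set0,
        forall a b, a <> b -> P a `&` P b = set0,
        \bigcup_a P a = [set: G] &
        forall u v : G, adj u v -> exists a b, [/\ a <> b, P a u & P b v]].

(* The least element of a set of natural numbers; [None], playing the role of
   infinity, if the set is empty. *)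
Definition least (A : set nat) : option nat :=
  match pselect (exists n, `[< A n >]) with
  | left h => Some (ex_minn h)
  | right _ => None
  end.

Lemma least_SomeP (A : set nat) (n : nat) :
  least A = Some n <-> A n /\ forall m, A m -> n <= m.
Proof.
rewrite /least; case: pselect => [h|h].
  case: ex_minnP => m /asboolP Am mP; split=> [[<-]|[An nP]].
    by split=> // p Ap; apply: mP; apply/asboolP.
  congr Some; apply/eqP; rewrite eqn_leq nP // andbT.
  by apply: mP; apply/asboolP.
by split=> // -[An _]; case: h; exists n; apply/asboolP.
Qed.

Definition colorable (G : sgraph) (n : nat) : Prop :=
  exists c : G -> 'I_n, forall u v : G, adj u v -> c u <> c v.

Definition chromatic_number (G : sgraph) : option nat :=
  least [set n | colorable G n].

Definition hom_complexity (G H : sgraph) : option nat :=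
  least [set k | 0 < k /\ exists S : 'I_k -> subgraph G,
    is_union S /\ forall i, inhabited (hom (S i) H)].

Record quasi_hom (k : nat) (G H : sgraph) := QuasiHom {
  qh_sub : 'I_k -> subgraph G;
  qh_union : is_union qh_sub;
  qh_map : forall i, hom (qh_sub i) H }.

Definition optimal k (G H : sgraph) (q : quasi_hom k G H) : Prop :=
  hom_complexity G H = Some k.

(* Main.v *)
(** Send the colours of a proper surjective colouring injectively to words of
length [k] over an alphabet of [l] letters, and let [G_i] keep the edges whose
ends differ in the [i]-th letter: the [i]-th letter is then a homomorphism
[G_i -> K_l], and every edge is kept by some [G_i]. As there are at least
[l ^ (k - 1) >= l] colours, the injection may be chosen to hit all the constant
words, which makes each letter map surjective. Conversely [m] homomorphisms of
subgraphs covering [G] to [K_l] combine into a colouring of [G] by words of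
length [m], so that [chi(G) <= l ^ m]; this gives optimality. *)
Require Import Defs.
From mathcomp Require Import all_boot.
From mathcomp Require Import boolp classical_sets.

Set Implicit Arguments.
Unset Strict Implicit.
Unset Printing Implicit Defensive.

Definition proper_coloring (G : sgraph) (T : Type) (c : G -> T) : Prop :=
  forall u v : G, adj u v -> c u <> c v.

Lemma proper_coloring_colorable (G : sgraph) (T : finType) (c : G -> T) :
  proper_coloring c -> colorable G #|T|.
Proof.
by move=> cP; exists (enum_rank \o c) => u v /cP cuv /enum_rank_inj.
Qed.

(** If [c] missed the colour [a], it would already be a proper colouring by the [n - 1] other
    colours, against the minimality of [n]. *)
Lemma minimal_coloring_surjective (G : sgraph) (n : nat) (c : G -> 'I_n) :
  (forall m, colorable G m -> n <= m) -> proper_coloring c ->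
  forall a, exists x, c x = a.
Proof.
move=> nmin cP a; apply: contrapT => /forallNP ca.
have ca' x : c x != a by apply/eqP/ca.
pose d x : {y | y != a} := exist _ (c x) (ca' x).
have dP : proper_coloring d by move=> u v /cP cuv [].
have := nmin _ (proper_coloring_colorable dP).
rewrite card_sig cardC1 card_ord leqNgt => /negP; apply.
by rewrite ltn_predL (leq_ltn_trans _ (ltn_ord a)).
Qed.

Lemma vertex_surjective_partite (G : sgraph) (l : nat)
    (f : hom G (complete_graph l)) :
  vertex_surjective f -> partite l G.
Proof.
move=> fsurj; exists (fun a => [set v | f v = a]%classic); split.
- by move=> a; have [x fx] := fsurj a; exists x.
- by move=> a b ab; apply/seteqP; split=> // x [/= fa fb]; case: ab; rewrite -fa.
- by apply/seteqP; split=> // x _; exists (f x).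
- by move=> u v uv; exists (f u), (f v); split=> //; exact: (hom_adj f uv).
Qed.

(** All [l ^ k] words are enumerated with the [l] constant ones first, and [x] is sent to the word
    at position [x]. Since [l <= j], the first [j] positions include every constant word. *)
Lemma injection_hitting_constants (l k j : nat) :
  0 < k -> l <= j -> j <= l ^ k ->
  exists w : 'I_j -> {ffun 'I_k -> 'I_l},
    injective w /\ forall a, exists x, w x = [ffun=> a].
Proof.
move=> k_gt0 lj jlk.
pose const (a : 'I_l) : {ffun 'I_k -> 'I_l} := [ffun=> a].
have const_inj : injective const.
  by move=> a b /ffunP/(_ (Ordinal k_gt0)); rewrite !ffunE.
pose cs := map const (enum 'I_l).
pose s := cs ++ [seq x <- enum {ffun 'I_k -> 'I_l} | x \notin cs].
have s_uniq : uniq s.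
  rewrite cat_uniq map_inj_uniq ?enum_uniq // filter_uniq ?enum_uniq // andbT.
  by apply/hasPn => x; rewrite mem_filter => /andP[].
have s_size : size s = l ^ k.
  have <- : #|{ffun 'I_k -> 'I_l}| = l ^ k by rewrite card_ffun !card_ord.
  rewrite cardE; apply: perm_size; apply: uniq_perm => //.
    exact: enum_uniq.
  by move=> x; rewrite mem_cat mem_filter mem_enum andbT orbN.
(* A default value for [nth]: there may be no word at all when [l = 0], but an element of ['I_j]
   forces [s] to be nonempty. *)
have x0 (x : 'I_j) : {ffun 'I_k -> 'I_l}.
  by case: (s) s_size (leq_trans (ltn_ord x) jlk) => [<-|].
exists (fun x => nth (x0 x) s x); split=> [x y|a].
  have xs z : z < j -> z < size s by move=> zj; rewrite s_size (leq_trans zj).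
  rewrite (set_nth_default (x0 x) (x0 y)) ?xs // => /eqP.
  by rewrite nth_uniq ?xs // => /eqP/val_inj.
exists (widen_ord lj a).
rewrite /= nth_cat size_map size_enum_ord ltn_ord (nth_map a) ?size_enum_ord //.
by rewrite nth_ord_enum.
Qed.

Section LetterSubgraph.
Variables (G : sgraph) (l : nat) (d : G -> 'I_l).

Definition bichromatic_edge (u v : G) : Prop := adj u v /\ d u <> d v.

Lemma bichromatic_edge_sym u v : bichromatic_edge u v -> bichromatic_edge v u.
Proof. by move=> [uv duv]; split; [exact: adj_sym | exact: nesym]. Qed.

(** Only edges are removed: keeping all vertices lets the surjectivity of [d] pass to the
    homomorphism. *)
Definition bichromatic_subgraph : subgraph G :=
  @Subgraph G setT bichromatic_edge bichromatic_edge_sym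
    (fun _ _ _ => I) (fun _ _ => @proj1 _ _).

Definition bichromatic_hom : hom bichromatic_subgraph (complete_graph l) :=
  @Hom bichromatic_subgraph (complete_graph l) (fun x => d (val x))
    (fun _ _ => @proj2 _ _).

Lemma bichromatic_hom_surjective :
  (forall a, exists x, d x = a) -> vertex_surjective bichromatic_hom.
Proof.
by move=> dsurj a; have [x <-] := dsurj a; exists (SigSub (mem_setT x)).
Qed.

End LetterSubgraph.

Lemma surjective_quasi_hom (G : sgraph) (l k j : nat) (c : G -> 'I_j) :
  0 < k -> l <= j -> j <= l ^ k ->
  proper_coloring c -> (forall a, exists x, c x = a) ->
  exists q : quasi_hom k G (complete_graph l),
    forall i, vertex_surjective (qh_map q i).
Proof.
move=> k_gt0 lj jlk cP csurj.
have [w [w_inj wconst]] := injection_hitting_constants k_gt0 lj jlk.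
pose d i x := w (c x) i.
have dU : is_union (fun i : 'I_k => bichromatic_subgraph (d i)).
  split=> [|u v]; first by apply/seteqP; split=> // x _; exists (Ordinal k_gt0).
  (* An edge lying in no subgraph would have ends whose words agree in every letter, hence ends of
     the same colour. *)
  split=> [uv|[i []]//]; apply: contrapT => /forallNP nuv.
  apply: (cP u v uv); apply: w_inj; apply/ffunP => i.
  by apply: contrapT => duv; apply: (nuv i).
exists (QuasiHom dU (fun i => bichromatic_hom (d i))) => i.
apply: bichromatic_hom_surjective => a.
have [y wy] := wconst a; have [x cx] := csurj y.
by exists x; rewrite /d cx wy ffunE.
Qed.

Lemma quasi_hom_colorable (G : sgraph) (l m : nat) :
  0 < l -> quasi_hom m G (complete_graph l) -> colorable G (l ^ m).
Proof.
move=> l_gt0 q.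
(* Off the [i]-th subgraph the letter is arbitrary. This is harmless: an edge [uv] of [G] lies in
   some subgraph together with both its ends, and there the letters differ. *)
pose f i x : 'I_l :=
  if pselect (x \in svert (qh_sub q i)) is left xS
  then qh_map q i (SigSub xS) else Ordinal l_gt0.
pose w x : {ffun 'I_m -> 'I_l} := [ffun i => f i x].
suff wP : proper_coloring w.
  by have := proper_coloring_colorable wP; rewrite card_ffun !card_ord.
move=> u v /((qh_union q).2 u v)[i uv] /ffunP/(_ i); rewrite !ffunE /f.
case: pselect => [uS|]; last by case; apply/mem_set/(sedge_vert uv).
case: pselect => [vS|]; last by case; apply/mem_set/(sedge_vert (sedge_sym uv)).
by apply: (hom_adj (qh_map q i)).
Qed.

Lemma optimal_of_chromatic_bound (G : sgraph) (l k : nat)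
    (q : quasi_hom k G (complete_graph l)) :
  1 < l -> 0 < k -> (forall m, colorable G m -> l ^ (k - 1) < m) -> optimal q.
Proof.
move=> l_gt1 k_gt0 Gl; apply/least_SomeP; split=> [|m [_ [S [SU Sf]]]].
  split=> //; exists (qh_sub q); split=> [|i]; first exact: qh_union.
  exact: (inhabits (qh_map q i)).
(* A cover by [m] subgraphs colours [G] with [l ^ m] colours, so [l ^ (k - 1) < l ^ m], that is
   [k <= m]. *)
have := Gl _ (quasi_hom_colorable (ltnW l_gt1)
  (QuasiHom SU (fun i => inhabited_witness (Sf i)))).
by rewrite ltn_exp2l // subn1 prednK.
Qed.

(** Distinct vertices are adjacent, so a proper colouring is injective. *)
Lemma complete_graph_colorable (j m : nat) :
  colorable (complete_graph j) m -> j <= m.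
Proof.
move=> [c cP]; rewrite -(card_ord j) -(card_ord m).
by apply: (leq_card c) => u v cuv; apply: contrapT => /cP.
Qed.

Theorem theorem3p36 (l : nat) (hl : 2 <= l) :
  ((forall k j : nat, 2 <= k -> l ^ (k - 1) <= j -> j <= l ^ k ->
      exists S : 'I_k -> subgraph (complete_graph j),
        is_union S /\
        forall i, partite l (S i) /\
          exists f : hom (S i) (complete_graph l), vertex_surjective f)
   /\
   (forall k j : nat, 2 <= k -> l ^ (k - 1) < j -> j <= l ^ k ->
      exists q : quasi_hom k (complete_graph j) (complete_graph l),
        optimal q /\ forall i, vertex_surjective (qh_map q i)))
  /\
  (forall (G : sgraph) (k c : nat), 2 <= k ->
      chromatic_number G = Some c -> l ^ (k - 1) < c -> c <= l ^ k ->
      exists q : quasi_hom k G (complete_graph l),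
        optimal q /\
        forall i, vertex_surjective (qh_map q i) /\ partite l (qh_sub q i)).
Proof.
have l_le k j : 2 <= k -> l ^ (k - 1) <= j -> l <= j.
  move=> k2; apply: leq_trans.
  by rewrite -{1}(expn1 l) leq_exp2l // subn_gt0.
have qK k j : 2 <= k -> l ^ (k - 1) <= j -> j <= l ^ k ->
    exists q : quasi_hom k (complete_graph j) (complete_graph l),
      forall i, vertex_surjective (qh_map q i).
  move=> k2 lj jl.
  (* The vertices of [K_j] serve as their own colours. *)
  apply: (@surjective_quasi_hom (complete_graph j) l k j id) => //.
  - exact: ltnW.
  - exact: l_le lj.
  - by move=> a; exists a.
split; first split.
- move=> k j k2 lj jl; have [q qsurj] := qK k j k2 lj jl.
  exists (qh_sub q); split=> [|i]; first exact: qh_union.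
  by split; [exact: vertex_surjective_partite (qsurj i) | exists (qh_map q i)].
- move=> k j k2 lj jl; have [q qsurj] := qK k j k2 (ltnW lj) jl.
  exists q; split=> //; apply: optimal_of_chromatic_bound => //.
    exact: ltnW.
  by move=> m /complete_graph_colorable; exact: leq_trans.
- move=> G k n k2 /least_SomeP[[c cP] nmin] ln nl.
  have csurj := minimal_coloring_surjective nmin cP.
  have [q qsurj] :=
    surjective_quasi_hom (ltnW k2) (l_le _ _ k2 (ltnW ln)) nl cP csurj.
  exists q; split=> [|i].
    apply: optimal_of_chromatic_bound => //; first exact: ltnW.
    by move=> m /nmin; exact: leq_trans.
  by split=> //; exact: vertex_surjective_partite (qsurj i).
Qed.
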